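(* For every $n \in \mathbb{N}$, the symmetric group $Sym_n$ on $\mathbb{Z}/n$, endowed with the word metric $d_{\{t,c\}}$ generated by the transposition $t = (0\,1)$ and the cycle $c = (0\,1\,2\,3\ldots n-1)$, embeds into $L_1$ with bi-Lipschitz distortion $O(1)$. Specifically, $$\sup_{n \in \mathbb{N}} c_1\big(Sym_n, d_{\{t,c\}}\big) < 1000.$$
   Context: $Sym_n$ is the group of permutations of $\mathbb{Z}/n = \{0,1,\ldots,n-1\}$ (products are read right to left, as composition of functions; for $n=1$ both $t$ and $c$ are understood as the identity). The word metric $d_{\{t,c\}}$ on $Sym_n$ is the shortest path metric on the (left) Cayley graph with vertex set $Sym_n$ and undirected edges joining $\pi$ to $t\pi$ and $\pi$ to $c\pi$ for all $\pi\in Sym_n$; equivalently $d_{\{t,c\}}(\pi,\tau)$ is the least length of a word in $t^{\pm1},c^{\pm1}$ representing $\tau\pi^{-1}$. For a metric space $(M,d)$, $c_1(M,d)$ is the infimum of all $D> 1$ for which there is a map $f : M \to L_1$ with $d(x,y) \le \|f(x)-f(y)\|_1 \le D\, d(x,y)$ for all $x,y\in M$. Here $L_1$ may be taken to be $L_1([0,1])$ or $\ell_1(\mathbb{N})$; for finite metric spaces this makes no difference. *)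

(* Defs.v *)
From mathcomp Require Import all_boot all_order all_algebra all_fingroup.
From mathcomp Require Import all_classical all_reals all_analysis.

Set Implicit Arguments.
Unset Strict Implicit.
Unset Printing Implicit Defensive.

(* The groups 'S_n.+1, n : nat, are exactly the groups Sym_m with m >= 1.     *)

(* For n = 0, [inord 1 : 'I_1] is [ord0], so this is the identity of 'S_1.    *)
Definition sym_t (n : nat) : 'S_n.+1 := tperm ord0 (inord 1).

Definition sym_c (n : nat) : 'S_n.+1 := perm (@ordS_inj n.+1).

(* The product of {perm T} reads left to right, (p * s)%g x = s (p x), so     *)
(* that [p * sym_t n] is the permutation written t p when products are read   *)
(* right to left: this is the left Cayley graph.                              *)
Definition cayley_edge (n : nat) : rel 'S_n.+1 := fun p q =>
  [|| q == (p * sym_t n)%g, p == (q * sym_t n)%g,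
      q == (p * sym_c n)%g | p == (q * sym_c n)%g].

Definition cayley_walk (n : nat) (p q : 'S_n.+1) : pred nat := fun k =>
  [exists s : k.-tuple 'S_n.+1,
    path (@cayley_edge n) p s && (last p s == q)].

Lemma sym_tc_gen (n : nat) : <<[set sym_t n; sym_c n]>>%g = [set: 'S_n.+1].
Proof.
case: n => [|n].
  apply/setP => s; rewrite inE; suff -> : s = 1%g by rewrite group1.
  by apply/permP => i; rewrite !ord1.
have <- : perm (@GRing.addrI 'I_n.+2 (1%R : 'I_n.+2)) = sym_c n.+1.
  by apply/permP => i; rewrite !permE; apply/val_inj.
rewrite /sym_t -(_ : 1%R = inord 1 :> 'I_n.+2); last first.
  by apply/val_inj; rewrite /= inordK.
by apply: gen_tpermn_circular_shift; rewrite GRing.subr0 /= coprimen1.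
Qed.

Lemma cayley_connect (n : nat) (p q : 'S_n.+1) : connect (@cayley_edge n) p q.
Proof.
have : (p^-1 * q)%g \in <<[set sym_t n; sym_c n]>>%g.
  by rewrite sym_tc_gen inE.
move=> /gen_prodgP[k [g gS pqE]].
have -> : q = (p * \prod_(i < k) g i)%g by rewrite -pqE mulKVg.
elim: k g gS {pqE} => [|k IH] g gS; first by rewrite big_ord0 mulg1.
rewrite big_ord_recr /= mulgA.
have gS' i : g (widen_ord (leqnSn k) i) \in [set sym_t n; sym_c n] by exact: gS.
apply: (connect_trans (IH _ gS')).
apply: connect1; have := gS ord_max; rewrite !inE /cayley_edge.
by case/orP => /eqP ->; rewrite eqxx ?orbT.
Qed.

Lemma cayley_walk_ex (n : nat) (p q : 'S_n.+1) : exists k, cayley_walk p q k.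
Proof.
have /connectP[s ps qE] := cayley_connect p q.
exists (size s); apply/existsP; exists (in_tuple s).
by rewrite /= ps qE eqxx.
Qed.

Definition word_dist (n : nat) (p q : 'S_n.+1) : nat :=
  ex_minn (cayley_walk_ex p q).

Local Open Scope classical_set_scope.
Local Open Scope ring_scope.
Local Open Scope ereal_scope.

(* As a target space L_1 we take l_1(N), i.e. L^1 of the counting measure on  *)
(* nat. The infimum is taken in \bar R: it is +oo when no D is admissible.    *)
Definition c1 (R : realType) (M : Type) (d : M -> M -> R) : \bar R :=
  ereal_inf [set D%:E | D in [set D : R | (1 < D)%R /\
    exists f : M -> LfunType (@counting nat R) (Order.POrderTheory.lexx (1 : \bar R)),
      forall x y : M,
        (d x y)%:E <= 'N[counting]_1[EFin \o (f x \- f y)%R]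
                   <= (D * d x y)%:E]].

(* Main.v *)
(* A permutation is read as a word listing the letters by position: c rotates
   this word and t swaps its first two letters. Up to constants, the distance is
   the least number of adjacent swaps plus the distance the head (the first two
   positions) has to travel along the cyclic word. Both parts are seen by 0/1
   coordinates:
   - the cyclic orientations of triples of letters: they are invariant under c,
     t changes O(N) of them, and counting those that contain a fixed letter z
     gives the number of inversions after cutting the cyclic word at z;
   - the factors of the word that avoid the head: they are invariant under t,
     c changes O(N) of them, and if W factors are not shared, then some shared
     factor has a complement of length O(1 + W/N).
   Sorting the complement of a long shared factor v by insertion bounds the
   distance by the length of the complement and its number of inversions, which
   is at most the number of inversions seen from any letter z of v; averaging
   over z in the middle of the word bounds both terms at once. *)

Require Import Defs.
From mathcomp Require Import all_boot all_order all_algebra all_fingroup.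
From mathcomp Require Import all_classical all_reals all_analysis.
From mathcomp Require Import zify.

Set Implicit Arguments.
Unset Strict Implicit.
Unset Printing Implicit Defensive.

Import Order.TTheory GRing.Theory Num.Theory.

(** * Hamming metrics in L_1 *)

Section HammingL1.
Local Open Scope ring_scope.
Local Open Scope ereal_scope.
Variable R : realType.

Lemma Lnorm1_counting_support (N : nat) (g : nat -> R) :
  (forall k, (N <= k)%N -> g k = 0%R) ->
  'N[@counting nat R]_1[EFin \o g] = (\sum_(k < N) `|g k|)%:E.
Proof.
move=> g0; rewrite Lnorm1 ge0_integral_count //=.
rewrite (@nneseries_split _ _ 0 N) // eseries0 ?adde0 ?add0n.
  by rewrite big_mkord sumEFin.
by move=> k /g0 -> _; rewrite normr0.
Qed.

Lemma Lfun1_support (N : nat) (g : nat -> R) :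
  (forall k, (N <= k)%N -> g k = 0%R) -> g \in Lfun (@counting nat R) 1.
Proof.
move=> g0; apply/andP; split; first by rewrite inE.
by rewrite inE /finite_norm /= (Lnorm1_counting_support g0) ltry.
Qed.

Lemma c1_hamming_le (M : Type) (d : M -> M -> R) (T : finType)
    (F : M -> T -> bool) (a D : R) : (0 < a)%R -> (1 < D)%R ->
  (forall x y, d x y <= a * (\sum_i (F x i != F y i))%N%:R <= D * d x y)%R ->
  c1 d <= D%:E.
Proof.
move=> a0 D1 dF; apply: ereal_inf_lbound; exists D => //; split => //.
(* The coordinates, enumerated and scaled by [a], are the first [#|T|] terms of a sequence that is 0
   from there on. *)
pose g x k : R :=
  if insub k is Some i then (a * (F x (enum_val (i : 'I_#|T|)))%:R)%R else 0%R.
have g0 x k : (#|T| <= k)%N -> g x k = 0%R by move=> ?; rewrite /g insubF ?ltnNge // negbF.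
exists (fun x => Lfun_Sub (Order.POrderTheory.lexx 1) (Lfun1_support (g0 x))) => x y.
rewrite (@Lnorm1_counting_support #|T|) /=; last first.
  by move=> k kT; rewrite /= !g0 // subrr.
rewrite !lee_fin (_ : (\sum_(_ < _) _ = a * (\sum_i (F x i != F y i))%N%:R)%R) //.
rewrite natr_sum mulr_sumr (big_enum_val (A := T)) /=.
apply: eq_bigr => k _; rewrite /g valK -mulrBr normrM gtr0_norm //.
by case: (F x _) (F y _) => [] []; rewrite ?subrr ?subr0 ?sub0r ?normrN ?normr1 ?normr0.
Qed.

End HammingL1.

(** * The word metric and insertion sort *)

Section Cayley.
Variable n : nat.
Implicit Types p q r : 'S_n.+1.

Lemma cayley_walkP p q k :
  reflect (exists s, [/\ size s = k, path (@cayley_edge n) p s & last p s = q])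
          (cayley_walk p q k).
Proof.
apply: (iffP existsP) => [[s /andP[ps /eqP qE]]|[s [sk ps qE]]].
  by exists s; rewrite size_tuple.
by move/eqP: sk => sk; exists (Tuple sk); rewrite /= ps qE eqxx.
Qed.

Lemma word_dist_le p q k : cayley_walk p q k -> word_dist p q <= k.
Proof. by move=> pqk; rewrite /word_dist; case: ex_minnP => m _; apply. Qed.

Lemma word_dist_walk p q : cayley_walk p q (word_dist p q).
Proof. by rewrite /word_dist; case: ex_minnP. Qed.

Lemma word_distxx p : word_dist p p = 0.
Proof.
by apply/eqP; rewrite -leqn0; apply/word_dist_le/cayley_walkP; exists [::].
Qed.

Lemma word_dist_edge p q : cayley_edge p q -> word_dist p q <= 1.
Proof.
by move=> pq; apply/word_dist_le/cayley_walkP; exists [:: q]; split=> //=; rewrite pq.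
Qed.

Lemma word_dist_trans q p r : word_dist p r <= word_dist p q + word_dist q r.
Proof.
apply/word_dist_le/cayley_walkP.
have /cayley_walkP[s [<- ps qE]] := word_dist_walk p q.
have /cayley_walkP[s' [<- ps' rE]] := word_dist_walk q r.
by exists (s ++ s'); rewrite size_cat cat_path last_cat qE ps.
Qed.

(** Summing along a shortest walk reduces a Lipschitz bound to single edges. *)
Lemma word_dist_lipschitz (f : 'S_n.+1 -> 'S_n.+1 -> nat) C :
  (forall p, f p p = 0) -> (forall p q r, f p r <= f p q + f q r) ->
  (forall p q, cayley_edge p q -> f p q <= C) ->
  forall p q, f p q <= C * word_dist p q.
Proof.
move=> f0 ftri fC p q.
have /cayley_walkP[s [<- ps <-]] := word_dist_walk p q.
elim: s p ps => [|x s IH] p /=; first by rewrite f0.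
case/andP => px xs; rewrite mulnS; apply: (leq_trans (ftri _ x _)).
by rewrite leq_add ?fC ?IH.
Qed.

End Cayley.

(** * Permutations as words, and the cost of rearranging them *)

Section Words.
Variable n : nat.
Implicit Types p q : 'S_n.+1.
Implicit Types s u v w : seq 'I_n.+1.

(* [p x] is the position of the letter [x]. *)
Definition wd p : seq 'I_n.+1 := [seq (p^-1)%g i | i <- enum 'I_n.+1].

Lemma size_wd p : size (wd p) = n.+1.
Proof. by rewrite size_map size_enum_ord. Qed.

Lemma index_wd p x : index x (wd p) = p x.
Proof.
by rewrite -{1}(permK p x) index_map ?index_enum_ord //; exact: perm_inj.
Qed.

Lemma wd_uniq p : uniq (wd p).
Proof. by rewrite map_inj_uniq ?enum_uniq //; exact: perm_inj. Qed.

Lemma mem_wd p x : x \in wd p.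
Proof. by rewrite -index_mem index_wd size_wd. Qed.

Lemma perm_eq_wd p q : perm_eq (wd p) (wd q).
Proof. by apply: uniq_perm; rewrite ?wd_uniq // => x; rewrite !mem_wd. Qed.

Lemma wd_inj : injective wd.
Proof.
by move=> p q pq; apply/permP => x; apply/val_inj; rewrite /= -!index_wd pq.
Qed.

(** Multiplying by [sym_c n] moves each letter one position to the right, cyclically; [rot 1] undoes
    this. *)
Lemma rot1_wd_c p : rot 1 (wd (p * sym_c n)%g) = wd p.
Proof.
rewrite /wd -map_rot.
suff -> : rot 1 (enum 'I_n.+1) = [seq sym_c n i | i <- enum 'I_n.+1].
  by rewrite -map_comp; apply: eq_map => i /=; rewrite invMg permM permK.
apply: (inj_map val_inj); rewrite map_rot val_enum_ord -map_comp.
rewrite (eq_map (g := (fun k => k.+1 %% n.+1) \o val)); last by move=> i; rewrite /= permE.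
rewrite map_comp val_enum_ord -[iota 0 n.+1]/(0 :: iota 1 n) rot1_cons.
have -> : 0 :: iota 1 n = rcons (iota 0 n) n.
  by rewrite -cats1 -[0 :: _]/(iota 0 n.+1) -addn1 iotaD.
rewrite map_rcons modnn; congr rcons; rewrite (iotaDl 1 0).
by apply/eq_in_map => k; rewrite mem_iota add0n => /andP[_ kn]; rewrite modn_small.
Qed.

Lemma wd_t p x y s : wd p = [:: x, y & s] -> wd (p * sym_t n)%g = [:: y, x & s].
Proof.
rewrite /wd; move: p x y s; case: n => [|m] p x y s.
  by move/(congr1 size); rewrite size_map size_enum_ord.
have -> : [seq ((p * sym_t m.+1)^-1)%g i | i <- enum 'I_m.+2] =
          [seq (p^-1)%g i | i <- [seq sym_t m.+1 i | i <- enum 'I_m.+2]].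
  by rewrite -[RHS]map_comp; apply: eq_map => i /=; rewrite invMg permM tpermV.
rewrite !enum_ordSl /= => -[<- <- <-].
rewrite (_ : lift ord0 ord0 = inord 1); last by apply/val_inj; rewrite /= inordK.
rewrite tpermL tpermR; congr [:: _, _ & _].
rewrite -!map_comp; apply: eq_map => i /=; rewrite tpermD //.
by rewrite -val_eqE /= inordK.
Qed.

(** Quantifying over [p] makes this vacuous when [s] is not the word of a permutation, so moves
    compose without side conditions. *)
Definition reach s s' k :=
  forall p, wd p = s -> exists2 q, wd q = s' & word_dist p q <= k.

Lemma reach_refl s : reach s s 0.
Proof. by move=> p ps; exists p => //; rewrite word_distxx. Qed.

Lemma reach_trans s2 s1 s3 k l : reach s1 s2 k -> reach s2 s3 l -> reach s1 s3 (k + l).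
Proof.
move=> r12 r23 p /r12[q /r23[r rE dr] dq]; exists r => //.
by rewrite (leq_trans (word_dist_trans q _ _)) ?leq_add.
Qed.

Lemma reach_leq s s' k l : k <= l -> reach s s' k -> reach s s' l.
Proof. by move=> kl r p /r[q ? dq]; exists q => //; exact: leq_trans kl. Qed.

Lemma reach_rotr x s : reach (rcons s x) (x :: s) 1.
Proof.
move=> p ps; exists (p * sym_c n)%g; last by rewrite word_dist_edge // /cayley_edge eqxx !orbT.
by apply: (@rot_inj 1); rewrite rot1_wd_c ps rot1_cons.
Qed.

Lemma reach_rotl x s : reach (x :: s) (rcons s x) 1.
Proof.
move=> p ps; exists (p * (sym_c n)^-1)%g.
  by rewrite -rot1_wd_c mulgKV ps rot1_cons.
by rewrite word_dist_edge // /cayley_edge mulgKV eqxx !orbT.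
Qed.

Lemma reach_swap x y s : reach [:: x, y & s] [:: y, x & s] 1.
Proof.
move=> p ps; exists (p * sym_t n)%g; first exact: wd_t.
by rewrite word_dist_edge // /cayley_edge eqxx.
Qed.

Lemma reach_catCl u v : reach (u ++ v) (v ++ u) (size u).
Proof.
elim: u v => [|x u IH] v; first by rewrite cats0; exact: reach_refl.
rewrite -cat_rcons /= -[(size u).+1]add1n; apply: (reach_trans (@reach_rotl _ _)).
by rewrite rcons_cat.
Qed.

Lemma reach_catCr u v : reach (u ++ v) (v ++ u) (size v).
Proof.
elim/last_ind: v u => [|v x IH] u; first by rewrite cats0; exact: reach_refl.
rewrite -rcons_cat size_rcons -[(size v).+1]add1n.
by apply: (reach_trans (@reach_rotr _ _)); rewrite cat_rcons; exact: (IH (x :: u)).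
Qed.

(** Passing a letter [a] costs 3: rotate [a] to the back, bring [z] past the rest of [u], rotate [a]
    to the front, swap it with [z]. *)
Lemma reach_bring_front u z w : reach (u ++ z :: w) (z :: u ++ w) (3 * size u).
Proof.
elim: u w => [|a u IH] w; first exact: reach_refl.
rewrite mulnS (_ : 3 + 3 * size u = 1 + (3 * size u + (1 + 1))); last by lia.
apply: (reach_trans (@reach_rotl _ _)); rewrite rcons_cat rcons_cons.
apply: (reach_trans (IH _)); rewrite -rcons_cat -rcons_cons.
by apply: (reach_trans (@reach_rotr _ _)); exact: reach_swap.
Qed.

(** Each inversion is one ordered pair, [x] being the letter that comes first in [v]. *)
Definition inverted v v' x y :=
  [&& x \in v, y \in v, index x v < index y v & index y v' < index x v'].

Lemma inverted_bring_front u z w v x y : uniq (u ++ z :: w) ->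
  inverted (u ++ w) v x y + ((x \in u) && (y == z)) <=
  inverted (u ++ z :: w) (z :: v) x y.
Proof.
move=> uzw.
have zu : z \notin u by move: uzw; rewrite cat_uniq /= negb_or => /and3P[_ /andP[]].
have zw : z \notin w by move: uzw; rewrite cat_uniq /= => /and4P[].
rewrite /inverted !mem_cat !inE !index_cat /=.
have [->|yz] := eqVneq y z.
  rewrite (negbTE zu) (negbTE zw) /= andbF add0n addn0 andbT /=.
  have [xu|//] := boolP (x \in u).
  have [xz|_] := eqVneq z x; first by rewrite -xz (negbTE zu) in xu.
  by rewrite index_mem xu.
rewrite andbF addn0.
have [->|xz] := eqVneq x z; first by rewrite (negbTE zu) (negbTE zw).
rewrite /= ltnS.
case: (boolP (x \in u)) => xu; case: (boolP (y \in u)) => yu /=.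
- by [].
- by case: (y \in w); case: (_ < index x v); lia.
- have F k : (size u + k < index y u) = false.
    by apply/negbTE; rewrite -leqNgt (leq_trans (index_size _ _)) ?leq_addr.
  by rewrite !F !andbF.
- by case: (x \in w); case: (y \in w); case: (_ < index x v); lia.
Qed.

Definition inv v v' := \sum_x \sum_y inverted v v' x y.

(* The pairs (x, z) with x in [u] pay for carrying [z] to the front. *)
Lemma inv_bring_front u z w v : uniq (u ++ z :: w) ->
  size u + inv (u ++ w) v <= inv (u ++ z :: w) (z :: v).
Proof.
move=> uzw.
have -> : size u = \sum_x \sum_y ((x \in u) && (y == z)).
  have /card_uniqP <- : uniq u by move: uzw; rewrite cat_uniq => /andP[].
  rewrite -sum1_card big_mkcond; apply: eq_bigr => x _.
  rewrite (bigD1 z) //= eqxx andbT big1 ?addn0; first by case: (x \in u).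
  by move=> y /negbTE ->; rewrite andbF.
rewrite addnC -big_split leq_sum // => x _; rewrite -big_split leq_sum // => y _.
exact: inverted_bring_front.
Qed.

(** Insertion sort: the first letter of [v'] is brought to the front and parked behind [u] while the
    others are sorted. The inversions it loses pay for bringing it, two rotations for parking it and
    fetching it back. *)
Lemma reach_sort v v' u : perm_eq v v' -> uniq v ->
  reach (v ++ u) (v' ++ u) (2 * size v + 3 * inv v v').
Proof.
elim: v' v u => [|z v' IH] v u.
  by move/perm_nilP => -> _; apply: reach_leq (@reach_refl _).
move=> vv' v_uniq; have zv : z \in v by rewrite (perm_mem vv') mem_head.
case/splitPr: zv vv' v_uniq => a b vv' v_uniq.
have abv' : perm_eq (a ++ b) v'.
  by rewrite -(perm_cons z) -(permPr vv') -cat1s -[z :: b]cat1s perm_catCA.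
have ab_uniq : uniq (a ++ b) by move: v_uniq; rewrite -cat1s uniq_catCA /= => /andP[].
rewrite -catA /=.
have := inv_bring_front v' v_uniq; set I := inv _ (z :: v'); set J := inv (a ++ b) v' => IJ.
apply: (@reach_leq _ _ (3 * size a + (1 + ((2 * size (a ++ b) + 3 * J) + 1)))).
  by rewrite !size_cat /=; lia.
apply: (reach_trans (@reach_bring_front _ _ _)).
apply: (reach_trans (@reach_rotl _ _)); rewrite catA rcons_cat.
apply: (reach_trans (IH _ _ abv' ab_uniq)); rewrite -rcons_cat.
exact: reach_rotr.
Qed.

End Words.

(** * Cyclic orientations *)

Section CyclicOrder.
Variable n : nat.
Implicit Types p q : 'S_n.+1.

Definition cyc (i j k : nat) := [|| i < j < k, j < k < i | k < i < j].

Lemma cyc_anti i j k : cyc i j k -> cyc j i k = false.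
Proof. by rewrite /cyc; lia. Qed.

Lemma cyc_succ_mod (i j k : nat) : i < n.+1 -> j < n.+1 -> k < n.+1 ->
  cyc (i.+1 %% n.+1) (j.+1 %% n.+1) (k.+1 %% n.+1) = cyc i j k.
Proof.
have succ_mod (l : nat) : l < n.+1 -> l.+1 %% n.+1 = if l == n then 0 else l.+1.
  by move=> ln; case: eqP => [->|?]; rewrite ?modnn // modn_small //; lia.
move=> i_n j_n k_n; rewrite !succ_mod // /cyc.
by case: eqP; case: eqP; case: eqP; lia.
Qed.

Definition corder p x y z := cyc (p x) (p y) (p z).

Lemma corder_c p x y z : corder (p * sym_c n)%g x y z = corder p x y z.
Proof. by rewrite /corder !permM !permE /= cyc_succ_mod. Qed.

(* Cutting the cyclic word at [z] turns cyclic orientation into linear order. *)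
Lemma corder_cut p (u v w : seq 'I_n.+1) x y z : wd p = u ++ v ++ w ->
  z \in v -> x \in w ++ u -> y \in w ++ u ->
  index x (w ++ u) < index y (w ++ u) -> corder p x y z.
Proof.
move=> pE zv; have := wd_uniq p; rewrite pE uniq_catC -catA.
rewrite cat_uniq has_cat negb_or => /and3P[v_uniq /andP[vw vu] wu_uniq].
have uw_disj t : t \in w -> t \notin u.
  move: wu_uniq; rewrite cat_uniq => /and3P[_ /hasPn uw _] tw.
  by apply/negP => /uw; rewrite /= tw.
have v_disj t : t \in v -> (t \notin u) && (t \notin w).
  move=> tv; apply/andP; split; apply/negP => tuw.
    by move/hasPn: vu => /(_ _ tuw); rewrite /= tv.
  by move/hasPn: vw => /(_ _ tuw); rewrite /= tv.
have /andP[/negbTE zu _] := v_disj _ zv.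
have not_v t : t \in w -> (t \in v) = false.
  by move=> tw; apply/negP => /v_disj; rewrite tw andbF.
rewrite /corder -!index_wd pE !mem_cat !index_cat zu zv.
have zvi : index z v < size v by rewrite index_mem.
(* The three possible places of [x] and [y], with [l] and [k] the lengths of [u] and [v]; [x] in [u]
   with [y] in [w] would put [y] first. *)
have cyc_ww a b c k l : a < b -> c < k -> cyc (l + (k + a)) (l + (k + b)) (l + c).
  by rewrite /cyc; lia.
have cyc_wu a b c k l : b < l -> c < k -> cyc (l + (k + a)) b (l + c).
  by rewrite /cyc; lia.
have cyc_uu a b c k l : k + a < k + b -> b < l -> cyc a b (l + c).
  by rewrite /cyc; lia.
case xw: (x \in w); case yw: (y \in w) => /=.
- rewrite !not_v // (negbTE (uw_disj _ xw)) (negbTE (uw_disj _ yw)) => _ _ xy.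
  exact: cyc_ww.
- rewrite not_v // (negbTE (uw_disj _ xw)) => _ yu; rewrite yu => _.
  by apply: cyc_wu; rewrite ?index_mem.
- move=> _ _ xy; suff : index y w < size w by move/(ltn_trans xy); rewrite ltnNge leq_addr.
  by rewrite index_mem.
- by move=> xu yu; rewrite xu yu => /cyc_uu -> //; rewrite index_mem.
Qed.

Definition cut_diff p q z := \sum_x \sum_y (corder p x y z != corder q x y z).

(** The letter [z] of the shared factor cuts both cyclic words, so an inverted pair has opposite
    orientations with [z] in [p] and [q]. *)
Lemma inv_le_cut_diff p q (u v w u' w' : seq 'I_n.+1) z :
  wd p = u ++ v ++ w -> wd q = u' ++ v ++ w' -> z \in v ->
  perm_eq (w ++ u) (w' ++ u') -> inv (w ++ u) (w' ++ u') <= cut_diff p q z.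
Proof.
move=> pE qE zv vv'; apply: leq_sum => x _; apply: leq_sum => y _.
rewrite /inverted; case: and4P => // -[xv yv xy yx].
rewrite (corder_cut pE zv xv yv xy) /corder cyc_anti //.
by apply: (corder_cut qE zv) yx; rewrite -(perm_mem vv').
Qed.

Definition order_diff p q := \sum_z cut_diff p q z.

Lemma sum_perm_le1 p : \sum_x (p x <= 1) <= 2.
Proof.
rewrite (reindex_inj (@perm_inj _ p^-1)) /=.
rewrite (eq_bigr (fun i : 'I_n.+1 => nat_of_bool (i <= 1)));
  last by move=> i _; rewrite permKV.
case: n => [|m]; first by rewrite big_ord_recl big_ord0.
by rewrite !big_ord_recl /= big1.
Qed.

Lemma sym_t_le1 (i : 'I_n.+1) : i <= 1 -> sym_t n i <= 1.
Proof.
have v1 : (inord 1 : 'I_n.+1) <= 1 by rewrite /inord val_insubd; case: ifP.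
by rewrite /sym_t; case: tpermP => [->|->|].
Qed.

Lemma sym_t_gt1 (i : 'I_n.+1) : 1 < i -> sym_t n i = i.
Proof.
move=> i_gt1; rewrite /sym_t tpermD //; apply: contraTneq i_gt1 => <- //.
by rewrite /inord val_insubd; case: ifP.
Qed.

(** If at most one of the three letters is in the head, it only moves between positions 0 and 1,
    below both others. Otherwise one of the products is 1. *)
Lemma corder_t p x y z :
  (corder p x y z != corder (p * sym_t n)%g x y z) <=
  (p x <= 1) * (p y <= 1) + (p y <= 1) * (p z <= 1) + (p z <= 1) * (p x <= 1).
Proof.
rewrite /corder !permM.
have cyc_rot i j k : cyc i j k = cyc j k i by rewrite /cyc; lia.
have cyc_small i i' j k : i <= 1 -> i' <= 1 -> 1 < j -> 1 < k -> cyc i j k = cyc i' j k.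
  by rewrite /cyc; lia.
have [xi|xi] := leqP (p x) 1; have [yi|yi] := leqP (p y) 1;
  have [zi|zi] := leqP (p z) 1; rewrite ?(sym_t_gt1 xi) ?(sym_t_gt1 yi) ?(sym_t_gt1 zi);
  try (by rewrite (leq_trans (leq_b1 _))); rewrite -[leqRHS]/0 leqn0 eqb0 negbK.
- by rewrite (cyc_small (p x) (sym_t n (p x))) ?sym_t_le1.
- by rewrite cyc_rot (cyc_rot (p x)) (cyc_small (p y) (sym_t n (p y))) ?sym_t_le1.
- by rewrite -(cyc_rot (p z)) -(cyc_rot (sym_t n _)) (cyc_small (p z) (sym_t n (p z))) ?sym_t_le1.
- by [].
Qed.

Lemma order_diff_t p : order_diff p (p * sym_t n)%g <= 12 * n.+1.
Proof.
have Sf : \sum_x (p x <= 1) <= 2 := sum_perm_le1 p.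
have Sg : \sum_x \sum_y (p x <= 1) * (p y <= 1) <= 4.
  by rewrite -big_distrlr (@leq_mul _ _ 2 2).
have S_const (m : nat) : \sum_(x < n.+1) m = n.+1 * m by rewrite sum_nat_const card_ord.
apply: (@leq_trans (\sum_z \sum_x \sum_y ((p x <= 1) * (p y <= 1) +
   (p y <= 1) * (p z <= 1) + (p z <= 1) * (p x <= 1)))).
  by do 3!apply: leq_sum => ? _; exact: corder_t.
under eq_bigr do (under eq_bigr do rewrite !big_split); rewrite /=.
under eq_bigr do rewrite !big_split; rewrite !big_split /=.
(* For each product there are at most four ordered pairs of head letters, and the third letter is
   free. *)
have -> : 12 * n.+1 = n.+1 * 4 + n.+1 * 4 + n.+1 * 4 by lia.
rewrite !leq_add //.
- by rewrite S_const leq_mul2l.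
- by rewrite exchange_big S_const exchange_big /= leq_mul2l.
- under eq_bigr do (under eq_bigr do rewrite S_const; rewrite -big_distrr); rewrite /=.
  by rewrite -big_distrr /= leq_mul2l.
Qed.

End CyclicOrder.

(** * Common factors *)

Section Factors.

(** Makes such counts comparable with the lengths of explicit lists of words. *)
Lemma sum_bseqE (T : finType) m (P : pred (seq T)) :
  \sum_(w : m.-bseq T) P w = size [seq val w | w <- enum {: m.-bseq T} & P (val w)].
Proof.
rewrite size_map size_filter -sum1_count big_enum_cond /= [RHS]big_mkcond /=.
by apply: eq_bigr => w _; case: (P _).
Qed.

Lemma sum_bseq_leq (T : finType) m (P : pred (seq T)) (L : seq (seq T)) :
  (forall w, P w -> w \in L) -> \sum_(w : m.-bseq T) P w <= size L.
Proof.
move=> PL; rewrite sum_bseqE uniq_leq_size //.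
  by rewrite (map_inj_uniq val_inj) filter_uniq ?enum_uniq.
by move=> _ /mapP[w + ->]; rewrite mem_filter => /andP[/PL].
Qed.

Lemma leq_sum_bseq (T : finType) m (P : pred (seq T)) (L : seq (seq T)) :
  uniq L -> (forall w, w \in L -> P w && (size w <= m)) ->
  size L <= \sum_(w : m.-bseq T) P w.
Proof.
move=> L_uniq LP; rewrite sum_bseqE uniq_leq_size // => w /LP /andP[Pw wm].
by apply/mapP; exists (Bseq wm) => //; rewrite mem_filter Pw mem_enum.
Qed.

Lemma sum_prefix_le (T : finType) m (s : seq T) :
  \sum_(w : m.-bseq T) prefix w s <= (size s).+1.
Proof.
have := @sum_bseq_leq T m (fun w => prefix w s) [seq take k s | k <- iota 0 (size s).+1].
rewrite size_map size_iota; apply => w ws; apply/mapP; exists (size w).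
  by rewrite mem_iota /= add0n ltnS size_prefix.
by move: ws; rewrite prefixE => /eqP.
Qed.

Lemma sum_suffix_le (T : finType) m (s : seq T) :
  \sum_(w : m.-bseq T) suffix w s <= (size s).+1.
Proof.
have := @sum_bseq_leq T m (fun w => suffix w s)
  [seq drop k s | k <- iota 0 (size s).+1].
rewrite size_map size_iota; apply => w /suffixP[v ->]; apply/mapP; exists (size v).
  by rewrite mem_iota /= add0n ltnS size_cat leq_addr.
by rewrite drop_size_cat.
Qed.

Lemma uniq_cat_cons_inj (T : eqType) (z : T) x y x' y' : uniq (x ++ z :: y) ->
  x ++ z :: y = x' ++ z :: y' -> x = x' /\ y = y'.
Proof.
move=> s_uniq sE; have := s_uniq; rewrite sE => s'_uniq.
have idx u v : uniq (u ++ z :: v) -> index z (u ++ z :: v) = size u.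
  rewrite cat_uniq /= negb_or => /and3P[_ /andP[/negbTE zu _] _].
  by rewrite index_cat zu /= eqxx addn0.
have xx' : size x = size x' by rewrite -(idx x y) // -(idx x' y') // sE.
by move/eqP: sE; rewrite eqseq_cat //= eqseq_cons eqxx /= => /andP[/eqP -> /eqP ->].
Qed.

(** As [z] occurs only once in [s], both factors meet at the same occurrence of [z]. *)
Lemma infix_glue (T : eqType) (z : T) u v s : uniq s ->
  infix (rcons u z) s -> infix (z :: v) s -> infix (u ++ z :: v) s.
Proof.
move=> s_uniq /infixP[a1 [a2 sE1]] /infixP[a3 [a4 sE2]].
have := @uniq_cat_cons_inj T z (a1 ++ u) a2 a3 (v ++ a4).
rewrite -catA -cat_rcons -sE1 => /(_ s_uniq sE2)[a3E a2E].
by apply/infixP; exists a1, a4; rewrite sE1 a2E cat_rcons -catA.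
Qed.

(** The pairs of endpoints in [I] and [J] give distinct factors: the position of [z] in a factor
    recovers [i], then its length recovers [j]. *)
Lemma leq_factor_diff (T : finType) m (P Q : pred (seq T)) (l r : seq T) z (I J : seq nat) :
  uniq (l ++ z :: r) -> size (l ++ z :: r) <= m -> uniq I -> uniq J ->
  (forall i, i \in I -> i <= size l) -> (forall j, j \in J -> j <= size r) ->
  (forall i j, i \in I -> j \in J -> P (drop i l ++ z :: take j r)) ->
  (forall i j, i \in I -> j \in J -> ~~ Q (drop i l ++ z :: take j r)) ->
  size I * size J <= \sum_(w : m.-bseq T) (P w != Q w).
Proof.
move=> s_uniq sm I_uniq J_uniq Il Jr PIJ QIJ.
rewrite -(size_allpairs (fun i j => drop i l ++ z :: take j r) I J).
apply: (leq_sum_bseq (P := fun w => P w != Q w)); last first.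
  move=> _ /allpairsP[[i j] /= [iI jJ ->]]; rewrite PIJ // (negbTE (QIJ _ _ _ _)) //=.
  apply: leq_trans sm; rewrite !size_cat size_drop /= size_take_min.
  by rewrite leq_add ?leq_subr ?ltnS ?geq_minr.
apply: allpairs_uniq => // ij ij' /allpairsP[[i j] /= [iI jJ ->]].
move=> /allpairsP[[i' j'] /= [i'I j'J ->]] /= wE.
have zl k : z \notin drop k l.
  by move: s_uniq; rewrite cat_uniq /= negb_or => /and3P[_ /andP[+ _] _];
    apply: contra => /mem_drop.
have idx k t : index z (drop k l ++ z :: t) = size l - k.
  by rewrite index_cat (negbTE (zl k)) /= eqxx addn0 size_drop.
have := congr1 (index z) wE; rewrite !idx => iE.
have := congr1 size wE; rewrite !size_cat !size_drop /= !size_takel ?Jr // => jE.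
have := Il _ iI; have := Il _ i'I => i'l il.
by suff [-> ->] : i = i' /\ j = j' by []; split; lia.
Qed.

(* [l2 ++ z :: r1] is the longest factor shared with [s] around [z]; any factor
   that contains [z] and starts before [l2] or ends after [r1] is not shared. If
   [z] does not occur in [s], no factor around [z] is shared. *)
Lemma maximal_common_factor (T : finType) m (l r s : seq T) (z : T) :
  uniq (l ++ z :: r) -> size (l ++ z :: r) <= m -> uniq s ->
  exists l1 l2 r1 r2,
    let W := \sum_(w : m.-bseq T) (infix w (l ++ z :: r) != infix w s) in
    [/\ l = l1 ++ l2, r = r1 ++ r2, infix (l2 ++ z :: r1) s \/ l2 ++ z :: r1 = [:: z],
        size l1 * (size r).+1 <= W & (size l).+1 * size r2 <= W].
Proof.
move=> lzr_uniq lzrm s_uniq.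
pose W := \sum_(w : m.-bseq T) (infix w (l ++ z :: r) != infix w s).
have bound I J := @leq_factor_diff T m (fun w => infix w (l ++ z :: r))
  (fun w => infix w s) l r z I J lzr_uniq lzrm.
have fact i j : infix (drop i l ++ z :: take j r) (l ++ z :: r).
  apply/infixP; exists (take i l), (drop j r).
  by rewrite -catA /= cat_take_drop catA cat_take_drop.
have [zs|zNs] := boolP (z \in s); last first.
  have notin i j : ~~ infix (drop i l ++ z :: take j r) s.
    by apply: contra zNs => /mem_infix; apply; rewrite mem_cat mem_head orbT.
  have := bound (iota 0 (size l).+1) (iota 0 (size r).+1).
  rewrite !size_iota => lrW.
  have {}lrW : (size l).+1 * (size r).+1 <= W.
    by apply: lrW; rewrite ?iota_uniq // => i; rewrite mem_iota /= add0n ltnS.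
  exists l, [::], [::], r; split; rewrite ?cats0 //; first by right.
    by apply: leq_trans lrW; rewrite leq_mul2r leqnSn orbT.
  by apply: leq_trans lrW; rewrite leq_mul2l leqnSn orbT.
have exL : exists i, infix (rcons (drop i l) z) s.
  by exists (size l); rewrite drop_size infix1s.
pose common_r j := (j <= size r) && infix (z :: take j r) s.
have exR : exists j, common_r j by exists 0; rewrite /common_r take0 infix1s.
have ubR j : common_r j -> j <= size r by case/andP.
case: (ex_minnP exL) (ex_maxnP exR ubR) => i0 lz_s min_i [j0 /andP[j0r zr_s] max_j].
have i0l : i0 <= size l by apply: min_i; rewrite drop_size infix1s.
exists (take i0 l), (drop i0 l), (take j0 r), (drop j0 r).
split; rewrite ?cat_take_drop ?size_takel ?size_drop //; first by left; exact: infix_glue.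
  (* Factors starting before [i0] are not shared, whatever their right end; below, likewise those
     ending after [j0]. *)
  have := bound (iota 0 i0) (iota 0 (size r).+1); rewrite !size_iota.
  apply; rewrite ?iota_uniq // => i; rewrite mem_iota ?add0n //=.
  - by move/ltnW/leq_trans; apply.
  - move=> j ii0 _; apply: contraTN ii0 => wS; rewrite -leqNgt min_i //.
    by move: wS; rewrite -cat_rcons => /catr_infix.
have := bound (iota 0 (size l).+1) (iota j0.+1 (size r - j0)); rewrite !size_iota.
apply; rewrite ?iota_uniq //.
- by move=> i; rewrite mem_iota.
- by move=> j; rewrite mem_iota; lia.
- move=> i j _; rewrite mem_iota => jr; apply/negP => /catl_infix zr.
  suff : j <= j0 by lia.
  by apply: max_j; rewrite /common_r zr andbT; lia.
Qed.

End Factors.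

(** * The embedding *)

Section Distortion.
Variable n : nat.
Implicit Types p q : 'S_n.+1.

Definition word_diff p q := \sum_(w : n.+1.-bseq 'I_n.+1)
  (infix w (drop 2 (wd p)) != infix w (drop 2 (wd q))).

Lemma word_diff_t p : word_diff p (p * sym_t n)%g = 0.
Proof.
rewrite /word_diff big1 // => w _.
have := @wd_t n p; case: (wd p) (wd (p * sym_t n)%g) (size_wd p) (size_wd (p * sym_t n)%g).
  by [].
move=> x [|y s] [|x' [|y' s']] //=; rewrite ?eqxx // => sn s'n; try lia.
by move/(_ _ _ _ erefl) => [_ _ ->]; rewrite eqxx.
Qed.

(** Without their heads the two words are [rcons s x] and [z :: s]. A factor of only one of them is
    a suffix of the former or a prefix of the latter. *)
Lemma word_diff_c p : word_diff p (p * sym_c n)%g <= 2 * n.+1.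
Proof.
have := rot1_wd_c p; have := size_wd (p * sym_c n)%g; rewrite /word_diff.
case: (wd (p * sym_c n)%g) => // x s /= [sn]; rewrite rot1_cons => <-.
case: s sn => [|y [|z s]] sn /=; try by rewrite big1 // => w _; rewrite eqxx.
rewrite drop0; apply: (@leq_trans (\sum_(w : n.+1.-bseq 'I_n.+1)
    (suffix w (rcons s x) + prefix w (z :: s)))); last first.
  rewrite big_split mul2n -addnn leq_add //.
    by apply: leq_trans (sum_suffix_le _ _) _; rewrite size_rcons -[n in _ <= n.+1]sn.
  by apply: leq_trans (sum_prefix_le _ _) _; rewrite -[n in _ <= n.+1]sn.
apply: leq_sum => w _; rewrite infix_rconsl -[X in _ != X]/(prefix w (z :: s) || infix w s).
by case: (suffix _ _); case: (prefix _ _); case: (infix _ s).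
Qed.

Lemma order_diff_c p : order_diff p (p * sym_c n)%g = 0.
Proof.
rewrite /order_diff big1 // => z _; rewrite /cut_diff big1 // => x _.
by rewrite big1 // => y _; rewrite corder_c eqxx.
Qed.

(* The first family gives a multiple 2N of the discrete metric; it absorbs the additive
   constants of the lower bound. *)
Definition coord : finType :=
  ('S_n.+1 * 'I_n.+1 + ('I_n.+1 * ('I_n.+1 * 'I_n.+1)) + n.+1.-bseq 'I_n.+1)%type.

Definition coords p (c : coord) : bool :=
  match c with
  | inl (inl (q, _)) => p == q
  | inl (inr (z, (x, y))) => corder p x y z
  | inr w => infix w (drop 2 (wd p))
  end.

Definition hamming p q := \sum_c (coords p c != coords q c).

Lemma hammingE p q :
  hamming p q = 2 * n.+1 * (p != q) + order_diff p q + word_diff p q.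
Proof.
rewrite /hamming /coord !big_sumType /=; congr (_ + _ + _).
  transitivity (\sum_(r : 'S_n.+1) \sum_(i < n.+1) ((p == r) != (q == r))).
    by rewrite pair_bigA; apply: eq_bigr => -[].
  under eq_bigr do rewrite sum_nat_const card_ord.
  rewrite -big_distrr /= mulnAC mulnC; congr (_ * _).
  have [->|pq] := eqVneq p q; first by rewrite big1 // => r _; rewrite eqxx.
  (* Only the indicators of [p] and of [q] differ, whence the factor 2. *)
  rewrite (bigD1 p) // (bigD1 q) /=; last by rewrite eq_sym.
  rewrite !eqxx (eq_sym q p) (negbTE pq) big1 // => r /andP[rp rq].
  by rewrite !(eq_sym _ r) (negbTE rp) (negbTE rq).
rewrite /order_diff /cut_diff; under [RHS]eq_bigr do rewrite pair_bigA.
by rewrite pair_bigA; apply: eq_bigr => -[z []].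
Qed.

(** The orientations contribute at most [12 * n.+1] for [t], the factors at most [2 * n.+1] for [c];
    the discrete part adds at most [2 * n.+1]. *)
Lemma hamming_edge p q : cayley_edge p q -> hamming p q <= 14 * n.+1.
Proof.
have hs p' q' : hamming p' q' = hamming q' p' by apply: eq_bigr => c _; rewrite eq_sym.
have ht p' : hamming p' (p' * sym_t n)%g <= 14 * n.+1.
  rewrite hammingE word_diff_t addn0; have := order_diff_t p'.
  by case: (_ != _); rewrite ?muln0 ?muln1; lia.
have hc p' : hamming p' (p' * sym_c n)%g <= 14 * n.+1.
  rewrite hammingE order_diff_c addn0; have := word_diff_c p'.
  by case: (_ != _); rewrite ?muln0 ?muln1; lia.
by case/or4P => /eqP ->; rewrite ?ht ?hc // hs.
Qed.

Lemma hamming_le p q : hamming p q <= 14 * n.+1 * word_dist p q.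
Proof.
apply: word_dist_lipschitz p q; last exact: hamming_edge.
  by move=> p; rewrite /hamming big1 // => c _; rewrite eqxx.
move=> p q r; rewrite -big_split leq_sum // => c _ /=.
by case: (coords p c); case: (coords q c); case: (coords r c).
Qed.

(** Rotate [w] to the front, sort [w ++ u] into [w' ++ u'] in front of [v], then rotate [w'] to the
    back. *)
Lemma word_dist_common_factor p q (u v w u' w' : seq 'I_n.+1) z :
  wd p = u ++ v ++ w -> wd q = u' ++ v ++ w' -> z \in v ->
  word_dist p q <= 4 * (size u + size w) + 3 * cut_diff p q z.
Proof.
move=> pE qE zv.
have wu : perm_eq (w ++ u) (w' ++ u').
  have := perm_eq_wd p q; rewrite pE qE perm_catC perm_sym perm_catC perm_sym.
  by rewrite -!catA perm_cat2l.
have wu_uniq : uniq (w ++ u).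
  by have := wd_uniq p; rewrite pE uniq_catC -catA cat_uniq => /and3P[].
have sz := perm_size wu; rewrite !size_cat in sz.
have := inv_le_cut_diff pE qE zv wu => inv_le.
have r : reach (u ++ v ++ w) (u' ++ v ++ w')
    (size w + (2 * size (w ++ u) + 3 * inv (w ++ u) (w' ++ u') + size w')).
  rewrite catA; apply: (reach_trans (@reach_catCr _ _ _)); rewrite catA.
  apply: (reach_trans (@reach_sort _ _ _ _ wu wu_uniq)).
  by rewrite -[(w' ++ u') ++ v]catA [u' ++ v ++ w']catA; exact: reach_catCl.
have [q' q'E d_le] := r p pE; have q'q : q' = q by apply: wd_inj; rewrite q'E qE.
rewrite {}q'q in d_le.
apply: leq_trans d_le _; rewrite size_cat.
have w'_le : size w' <= size w + size u by rewrite sz leq_addr.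
by move: (size u) (size w) (size w') (inv _ _) (cut_diff _ _ _) w'_le inv_le => *; lia.
Qed.

(* A letter in the middle half lies in quadratically many factors, so that the
   bounds of [maximal_common_factor] are of the form (missing length) * N. *)
Lemma common_factor p q z : n.+1 %/ 4 <= p z < n.+1 %/ 4 + uphalf n.+1 ->
  exists u v w u' w', [/\ wd p = u ++ v ++ w, wd q = u' ++ v ++ w', z \in v &
    n.+1 * (size u + size w) <= 12 * n.+1 + 12 * word_diff p q].
Proof.
move=> pz_mid.
have split_at r : exists l t, wd r = l ++ z :: t.
  by have := mem_wd r z; case/splitPr => l t; exists l, t.
(* For short words the single letter [z] is a good enough common factor; for longer ones the middle
   half avoids the head. *)
have [n_small|n_big] := leqP n.+1 12.
  have [l [t pE]] := split_at p; have [l' [t' qE]] := split_at q.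
  exists l, [:: z], t, l', t'; rewrite mem_head; split=> //.
  have sz := size_wd p; rewrite pE size_cat /= in sz.
  by rewrite (leq_trans _ (leq_addr _ _)) // mulnC leq_mul2r; lia.
have [a [b [l pE]]] : exists a b l, wd p = [:: a, b & l].
  have := size_wd p; case: (wd p) => [|a [|b l]] //= sz; first lia.
  by exists a, b, l.
have pz_gt1 : 1 < p z by lia.
have zl : z \in l.
  have := mem_wd p z; rewrite pE !inE; have := index_wd p z; rewrite pE /=.
  by rewrite !(eq_sym z); case: eqP => [_|_]; [lia|case: eqP => [_|_]; [lia|]].
case/splitPr: zl pE => l1 l2 pE.
have p_uniq := wd_uniq p.
have sz_p := size_wd p; rewrite pE /= size_cat /= in sz_p.
have pzE : (p z : nat) = 2 + size l1.
  have pE' : wd p = ([:: a; b] ++ l1) ++ z :: l2 by rewrite pE.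
  move: p_uniq; rewrite pE' cat_uniq /= negb_or => /and3P[_ /andP[/negbTE zl _] _].
  by rewrite -index_wd pE' index_cat zl /= eqxx addn0.
have dropE : drop 2 (wd p) = l1 ++ z :: l2 by rewrite pE /= drop0.
have [||| l11 [l12 [l21 [l22 [l1E l2E fact]]]]] :=
  @maximal_common_factor _ n.+1 l1 l2 (drop 2 (wd q)) z.
- by rewrite -dropE drop_uniq.
- by rewrite -dropE size_drop size_wd leq_subr.
- by rewrite drop_uniq ?wd_uniq.
rewrite -dropE -/(word_diff p q) => le1 le2.
have [u' [w' qE]] : exists u' w', wd q = u' ++ (l12 ++ z :: l21) ++ w'.
  case: fact => [/infixP[u' [w' qE]]|->]; last first.
    by have [u' [w' qE]] := split_at q; exists u', w'.
  by exists (take 2 (wd q) ++ u'), w'; rewrite -[LHS](cat_take_drop 2) qE -[RHS]catA.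
exists ([:: a; b] ++ l11), (l12 ++ z :: l21), l22, u', w'; split=> //.
- by rewrite pE l1E l2E -!catA.
- by rewrite mem_cat mem_head orbT.
rewrite l1E l2E size_cat /= size_cat in sz_p le1 le2 pzE.
rewrite size_cat /=.
move: (word_diff p q) (p z : nat) sz_p le1 le2 pzE pz_mid pz_gt1 n_big => W i.
move: (size l11) (size l12) (size l21) (size l22) => m1 m2 m3 m4 sz le1 le2 -> i_mid _ n_big.
(* About a quarter of the word lies on each side of [z]; on the left, dropping the head weakens the
   constant to 8. *)
have h1 : n.+1 <= 4 * (m3 + m4).+1 by lia.
have h2 : n.+1 <= 8 * (m1 + m2).+1 by lia.
have k1 : n.+1 * m1 <= 4 * W by nia.
have k2 : n.+1 * m4 <= 8 * W by nia.
nia.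
Qed.

Lemma exists_le_average (g : nat -> nat) a b : a < b ->
  exists2 i, a <= i < b & (b - a) * g i <= \sum_(a <= i < b) g i.
Proof.
move=> ab; apply: contrapT => no_i; set S := \sum_(a <= i < b) g i.
suff : (b - a) * S.+1 <= (b - a) * S by rewrite leq_mul2l ltnn orbF; lia.
rewrite -[in leqRHS]/S big_distrr /= -sum_nat_const_nat !big_nat leq_sum // => i aib.
by rewrite ltnNge; apply/negP => le; apply: no_i; exists i.
Qed.

Lemma word_dist_le_hamming p q : n.+1 * word_dist p q <= 48 * hamming p q.
Proof.
have [->|pq] := eqVneq p q; first by rewrite word_distxx muln0.
pose g i := cut_diff p q ((p^-1)%g (inord i)).
have [|i i_mid gi] := @exists_le_average g (n.+1 %/ 4) (n.+1 %/ 4 + uphalf n.+1).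
  by rewrite -[X in X < _]addn0 ltn_add2l.
pose z := (p^-1)%g (inord i).
have pz : p z = i :> nat by rewrite permKV inordK //; lia.
have [|u [v [w [u' [w' [pE qE zv uw]]]]]] := @common_factor p q z; first by rewrite pz.
have d_le := word_dist_common_factor pE qE zv.
have sum_g : \sum_(n.+1 %/ 4 <= i < n.+1 %/ 4 + uphalf n.+1) g i <= order_diff p q.
  rewrite /order_diff (reindex_inj (@perm_inj _ p^-1)) /=.
  have -> : \sum_(i < n.+1) cut_diff p q (p^-1 i)%g = \sum_(0 <= i < n.+1) g i.
    by rewrite big_mkord; apply: eq_bigr => i' _; rewrite /g inord_val.
  have b_le : n.+1 %/ 4 + uphalf n.+1 <= n.+1 by lia.
  rewrite [leqRHS](big_cat_nat (n := n.+1 %/ 4)) ?leq_div //=.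
  by rewrite [X in _ <= _ + X](big_cat_nat (leq_addr _ _) b_le) /= addnCA leq_addr.
(* The average runs over [uphalf n.+1] positions, at least half of all. *)
have gz : n.+1 * cut_diff p q z <= 2 * order_diff p q.
  have := leq_trans gi sum_g; rewrite addKn -[g i]/(cut_diff p q z) => le.
  apply: (@leq_trans (2 * (uphalf n.+1 * cut_diff p q z))); last by rewrite leq_mul2l.
  by rewrite mulnA leq_mul2r; lia.
(* The factor 48 is 4 times the 12 of [common_factor]; the discrete part covers the additive
   [48 * n.+1]. *)
rewrite hammingE pq muln1 (leq_trans (leq_mul (leqnn n.+1) d_le)) //.
by rewrite mulnDr mulnCA (mulnCA _ 3); lia.
Qed.

End Distortion.

Theorem theorem1 (R : realType) :
  (ereal_sup (range (fun n : nat =>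
     @c1 R 'S_n.+1 (fun p q => (word_dist p q)%:R%R))) < 1000%:E)%E.
Proof.
(* Here 672 is 48 times 14, the product of the constants of the two bounds. *)
apply: (@le_lt_trans _ _ (672%:R%:E)); last by rewrite lte_fin ltr_nat.
apply: ge_ereal_sup => _ [n _ <-].
apply: (@c1_hamming_le _ _ _ _ (@coords n) (48%:R / n.+1%:R)%R).
- by rewrite divr_gt0 ?ltr0n.
- by rewrite ltr1n.
move=> p q; rewrite -/(hamming p q) mulrAC ler_pdivlMr ?ltr0n // ler_pdivrMr ?ltr0n //.
rewrite -!natrM !ler_nat mulnC word_dist_le_hamming /=.
by have := hamming_le p q; lia.
Qed.
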